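(* Let $T\in GL(X)$ be a generalized hyperbolic operator, where $X$ is a sequentially complete locally convex space over $\mathbb{K}$ ($\mathbb{K}=\mathbb{R}$ or $\mathbb{C}$). For every neighborhood $V$ of $0$ in $X$, there exists a neighborhood $U$ of $0$ in $X$ such that for any homeomorphism (respectively, any uniform homeomorphism) $S:X\to X$ satisfying $$T-S\text{ is a bounded map}\quad\text{and}\quad Tx-Sx\in U\text{ for all }x\in X,$$ there is a continuous map (respectively, a uniformly continuous map) $\phi:X\to X$ with $$T\circ\phi=\phi\circ S\quad\text{and}\quad\phi(x)-x\in V\text{ for all }x\in X.$$
   Context: All topological vector spaces are Hausdorff. $\mathbb{N}_0=\{0,1,2,\dots\}$. $GL(X)$ is the set of continuous linear operators on $X$ having a continuous inverse. $X$ is sequentially complete if every Cauchy sequence in $X$ converges in $X$. A subset $E\subset X$ is bounded if for each neighborhood $V$ of $0$ there is $r>0$ with $E\subset\lambda V$ whenever $|\lambda|\ge r$; a map $f:X\to X$ is bounded if $f(X)$ is a bounded set. A uniform homeomorphism is a bijection that is uniformly continuous together with its inverse. The maps $S$ and $\phi$ are not assumed linear. Generalized hyperbolic: let the topology of $X$ be induced by a family $(\|\cdot\|_\alpha)_{\alpha\in I}$ of seminorms that is directed (for all $\alpha,\beta\in I$ there is $\gamma\in I$ with $\|\cdot\|_\alpha\le\|\cdot\|_\gamma$ and $\|\cdot\|_\beta\le\|\cdot\|_\gamma$); the notion does not depend on the choice of this family. $T\in GL(X)$ is generalized hyperbolic if there is a topological direct sum decomposition $X=M\oplus N$ (algebraic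 direct sum with $(y,z)\mapsto y+z$ a homeomorphism $M\times N\to X$) such that $T(M)\subset M$, $T^{-1}(N)\subset N$, and for every $\alpha\in I$ there exist $\beta\in I$, $c>0$, $t\in(0,1)$ with $\|T^ny\|_\alpha\le c\,t^n\|y\|_\beta$ and $\|T^{-n}z\|_\alpha\le c\,t^n\|z\|_\beta$ for all $y\in M$, $z\in N$, $n\in\mathbb{N}_0$. *)

(* Defs.v *)
From mathcomp Require Import all_boot all_order all_algebra.
From mathcomp Require Import complex.
From mathcomp Require Import boolp classical_sets functions cardinality.
From mathcomp Require Import reals topology tvs.

Set Implicit Arguments.
Unset Strict Implicit.
Unset Printing Implicit Defensive.

Import Order.TTheory GRing.Theory Num.Theory.

Local Open Scope classical_set_scope.
Local Open Scope ring_scope.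

(* The order of [R[i]] is partial, [0 <= x] meaning that [x] is a nonnegative
   real.  Absolute values, seminorms and positive constants can therefore be
   taken in the scalar field itself in both cases, as is done for norms in
   [normedModType]. *)
Definition scalar_field (R : realType) (cplx : bool) : numFieldType :=
  if cplx then (R[i] : numFieldType) else (R : numFieldType).

Definition homeomorphism (Y Z : topologicalType) (f : Y -> Z) : Prop :=
  continuous f /\
  exists g : Z -> Y, [/\ cancel f g, cancel g f & continuous g].

Section LocallyConvexSpaces.
Context (K : numFieldType) (X : tvsType K).
Implicit Types (E M N U V : set X) (f S : X -> X).

(* A [tvsType] is a locally convex space equipped with some uniformity that
   induces its topology; that uniformity need not be translation invariant.  So
   the library's [cauchy] and [unif_continuous] cannot be used here: uniform
   notions are those of the translation-invariant uniformity, expressed through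
   the neighborhoods of [0]. *)
Definition tvs_cauchy (u : nat -> X) : Prop :=
  forall V, nbhs (0 : X) V ->
  exists n0, forall m n, (n0 <= m)%N -> (n0 <= n)%N -> V (u m - u n).

Definition sequentially_complete : Prop :=
  forall u : nat -> X, tvs_cauchy u -> exists l : X, u @ \oo --> l.

Definition tvs_unif_continuous f : Prop :=
  forall V, nbhs (0 : X) V ->
  exists2 U, nbhs (0 : X) U & forall x y, U (x - y) -> V (f x - f y).

Definition uniform_homeomorphism f : Prop :=
  tvs_unif_continuous f /\
  exists g, [/\ cancel f g, cancel g f & tvs_unif_continuous g].

(* The library's [bounded_set] refers to a norm. *)
Definition tvs_bounded E : Prop :=
  forall V, nbhs (0 : X) V ->
  exists2 r : K, 0 < r & forall l : K, r <= `|l| -> E `<=` *:%R l @` V.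

Definition bounded_map f : Prop := tvs_bounded (range f).

Record GL := MkGL {
  GL_val :> {linear X -> X};
  GL_inv : X -> X;
  GL_valK : cancel GL_val GL_inv;
  GL_invK : cancel GL_inv GL_val;
  GL_continuous : continuous GL_val;
  GL_inv_continuous : continuous GL_inv }.

Record seminorm (p : X -> K) : Prop := MkSeminorm {
  seminorm_ge0 : forall x, 0 <= p x;
  seminormD : forall x y, p (x + y) <= p x + p y;
  seminormZ : forall (a : K) x, p (a *: x) = `|a| * p x }.

Section SeminormFamily.
Context (I : Type) (p : I -> X -> K).

Definition directed_family : Prop :=
  forall a b : I, exists c : I, forall x, p a x <= p c x /\ p b x <= p c x.

Definition induces_topology : Prop :=
  forall (x : X) U, nbhs x U <->
    exists (F : set I) (e : K),
      [/\ finite_set F, 0 < e &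
          [set y | forall a, F a -> p a (y - x) < e] `<=` U].

Definition defining_seminorms : Prop :=
  [/\ inhabited I, forall a, seminorm (p a), directed_family
    & induces_topology].

End SeminormFamily.

(* [M * N] is the product of the subtypes of [X] associated with [M] and [N],
   with the product of the subspace topologies; bijectivity of the sum map is
   the algebraic direct sum condition. *)
Definition topological_direct_sum M N : Prop :=
  [/\ GRing.submod_closed (mem M), GRing.submod_closed (mem N)
    & homeomorphism (fun yz : (M * N)%type => set_val yz.1 + set_val yz.2)].

Definition generalized_hyperbolic_wrt (I : Type) (p : I -> X -> K) (T : GL)
    : Prop :=
  exists M N : set X,
  [/\ topological_direct_sum M N,
      T @` M `<=` M,
      GL_inv T @` N `<=` N
    & forall a : I, exists (b : I) (c t : K),
        [/\ 0 < c, 0 < t < 1,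
            forall n y, M y -> p a (iter n T y) <= c * t ^+ n * p b y
          & forall n z, N z ->
              p a (iter n (GL_inv T) z) <= c * t ^+ n * p b z]].

End LocallyConvexSpaces.

(* Main.v *)
Require Import Defs.
From mathcomp Require Import all_boot all_order all_algebra.
From mathcomp Require Import complex ring.
From mathcomp Require Import boolp classical_sets functions cardinality.
From mathcomp Require Import reals topology tvs.

Set Implicit Arguments.
Unset Strict Implicit.
Unset Printing Implicit Defensive.

Import Order.TTheory GRing.Theory Num.Theory.

Local Open Scope classical_set_scope.
Local Open Scope ring_scope.

(** Put [f = T - S] and look for [phi = id + h - k].  With [P] and [Q] the
    projections onto [M] and [N], the equation [T \o phi = phi \o S] follows from
    [h (S x) = P (f x) + T (h x)] and [T (k x) = Q (f x) + k (S x)], which are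
    solved by the series
      [h x = \sum_n T^n (P (f (S^-(n+1) x)))] and
      [k x = \sum_n T^-(n+1) (Q (f (S^n x)))].
    Since [f] is bounded and [T^n \o P], [T^-(n+1) \o Q] decay geometrically in
    every seminorm, both converge uniformly on [X], so that [h] and [k] are as
    (uniformly) continuous as their terms, and small when [f] is small. *)

(** * Geometric decay in a partially ordered scalar field *)

Lemma bernoulli_le (K : numFieldType) (s : K) n :
  0 <= s -> 1 + n%:R * s <= (1 + s) ^+ n.
Proof.
move=> s0; elim: n => [|n IHn]; first by rewrite mul0r addr0 expr0.
have s1 : 0 <= 1 + s by rewrite addr_ge0.
apply: le_trans (_ : (1 + s) * (1 + n%:R * s) <= _); last first.
  by rewrite exprS ler_wpM2l.
rewrite -subr_ge0 -natr1.
have -> : (1 + s) * (1 + n%:R * s) - (1 + (n%:R + 1) * s) = n%:R * s * s by ring.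
by rewrite !mulr_ge0.
Qed.

(** The order of [K] may be partial, but positive elements are real, hence comparable with each
    other. *)
Lemma min_pos (K : numFieldType) (a b : K) :
  0 < a -> 0 < b -> exists d : K, [/\ 0 < d, d <= a & d <= b].
Proof.
move=> a0 b0.
have /orP[ab|ba] := real_leVge (gtr0_real a0) (gtr0_real b0).
- by exists a.
- by exists b.
Qed.

Lemma geometric_lt (K : numFieldType) :
  (forall x : K, 0 < x -> exists n, x < n%:R) ->
  forall c t e : K, 0 <= c -> 0 < t < 1 -> 0 < e ->
  exists n0, forall n, (n0 <= n)%N -> c * t ^+ n < e.
Proof.
move=> archK c t e c0 /andP[t0 t1] e0.
(* With [t^-1 = 1 + s], Bernoulli's inequality gives [t ^+ n * (1 + n%:R * s) <= 1]. *)
pose s := t^-1 - 1.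
have s0 : 0 < s by rewrite subr_gt0 invf_gt1.
have c1 : 0 < 1 + c by rewrite ltr_wpDr.
(* Replacing [c] by [1 + c] keeps the numerator positive when [c = 0]. *)
have [n0 hn0] := archK ((1 + c) / (e * s)) (divr_gt0 c1 (mulr_gt0 e0 s0)).
exists n0 => n n0n.
have hn : 1 + c < n%:R * (e * s).
  rewrite -ltr_pdivrMr ?mulr_gt0 //; apply: lt_le_trans hn0 _.
  by rewrite ler_nat.
have tn : t ^+ n * (1 + n%:R * s) <= 1.
  apply: le_trans (_ : t ^+ n * (1 + s) ^+ n <= 1).
    by rewrite ler_pM2l ?exprn_gt0 // bernoulli_le // ltW.
  by rewrite /s addrC subrK exprVn divff // expf_neq0 // gt_eqF.
have tn0 : 0 < t ^+ n by rewrite exprn_gt0.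
apply: le_lt_trans (_ : (1 + c) * t ^+ n < e).
  by rewrite ler_pM2r // lerDr.
apply: lt_le_trans (_ : n%:R * (e * s) * t ^+ n <= e); first by rewrite ltr_pM2r.
have -> : n%:R * (e * s) * t ^+ n = e * (t ^+ n * (n%:R * s)) by ring.
apply: le_trans (_ : e * (t ^+ n * (1 + n%:R * s)) <= _).
  by rewrite ler_pM2l // ler_pM2l // lerDr.
by rewrite -[leRHS]mulr1 ler_pM2l.
Qed.

(** * Linear maps, iterates and the projections of a direct sum *)

Lemma linear_fun_sub (K : pzRingType) (E F : lmodType K) (f : E -> F) :
  linear f -> forall x y, f (x - y) = f x - f y.
Proof. by move=> fl x y; rewrite addrC -scaleN1r fl scaleN1r addrC. Qed.

Lemma linear_fun0 (K : pzRingType) (E F : lmodType K) (f : E -> F) :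
  linear f -> f 0 = 0.
Proof. by move=> fl; rewrite -(subrr 0) (linear_fun_sub fl) subrr. Qed.

Lemma iter_sub (E : zmodType) (f : E -> E) :
  (forall x y, f (x - y) = f x - f y) ->
  forall n x y, iter n f (x - y) = iter n f x - iter n f y.
Proof. by move=> fB; elim=> //= n IHn x y; rewrite IHn fB. Qed.

Lemma GL_inv_linear (K : numFieldType) (X : tvsType K) (T : GL X) :
  linear (GL_inv T).
Proof.
by move=> a u v; apply: (can_inj (GL_valK T)); rewrite linearP !(GL_invK T).
Qed.

Lemma iter_continuous (E : topologicalType) (f : E -> E) n :
  continuous f -> continuous (iter n f).
Proof.
move=> fc; elim: n => [|n IHn] x; first exact: cvg_id.
exact: (continuous_comp (IHn x) (fc _)).
Qed.

Lemma tvs_unif_continuous_comp (K : numFieldType) (X : tvsType K)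
    (f g : X -> X) :
  tvs_unif_continuous f -> tvs_unif_continuous g ->
  tvs_unif_continuous (g \o f).
Proof.
move=> fc gc V /gc[W /fc[U U0 UW] WV]; exists U => // x y /UW; exact: WV.
Qed.

Lemma tvs_unif_continuous_iter (K : numFieldType) (X : tvsType K)
    (f : X -> X) n :
  tvs_unif_continuous f -> tvs_unif_continuous (iter n f).
Proof.
move=> fc; elim: n => [|n IHn]; first by move=> V V0; exists V.
exact: tvs_unif_continuous_comp IHn fc.
Qed.

(** The projections are the two components of the inverse of the sum map: they are continuous
    because that inverse is, and linear because decompositions are unique. *)
Lemma topological_direct_sum_projections (K : numFieldType) (X : tvsType K)
    (M N : set X) :
  topological_direct_sum M N ->
  exists P Q : X -> X,
  [/\ forall x, M (P x) /\ N (Q x), forall x, P x + Q x = x,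
     linear P /\ linear Q & continuous P /\ continuous Q].
Proof.
move=> [[M0 Mlin] [N0 Nlin] [_ [g [gK Kg gc]]]].
pose P x : X := set_val (g x).1; pose Q x : X := set_val (g x).2.
have PQ x : P x + Q x = x by exact: Kg.
have MP x : M (P x) by exact: set_valP.
have NQ x : N (Q x) by exact: set_valP.
have uniq y z : M y -> N z -> P (y + z) = y /\ Q (y + z) = z.
  move=> My Nz.
  have := gK (exist _ y (mem_set My), exist _ z (mem_set Nz)).
  by rewrite /P /Q /= => ->.
have lin a x y : P (a *: x + y) = a *: P x + P y /\
    Q (a *: x + y) = a *: Q x + Q y.
  rewrite -{1 3}(PQ x) -{1 3}(PQ y) scalerDr addrACA; apply: uniq.
  - by apply/set_mem/Mlin; apply/mem_set.
  - by apply/set_mem/Nlin; apply/mem_set.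
exists P, Q; split=> //.
- by split=> a x y; case: (lin a x y).
- split=> x.
  + apply: (@continuous_comp _ _ _ (fun x => (g x).1) set_val).
      by apply: (continuous_comp (gc x)); exact: cvg_fst.
    exact: initial_continuous.
  + apply: (@continuous_comp _ _ _ (fun x => (g x).2) set_val).
      by apply: (continuous_comp (gc x)); exact: cvg_snd.
    exact: initial_continuous.
Qed.

(** In the complex case a positive element has zero imaginary part, so the bound comes from its real
    part. *)
Lemma scalar_field_archi (R : realType) cplx (x : scalar_field R cplx) :
  0 < x -> exists n, x < n%:R.
Proof.
case: cplx x => x /=; last first.
  by move=> x0; exists (Num.bound x); apply/archi_boundP/ltW.
case: x => a b; rewrite ltcE /= => /andP[/eqP b0 a0].
exists (Num.bound a); rewrite -(rmorph_nat (real_complex R)) ltcE /= b0 eqxx /=.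
exact/archi_boundP/ltW.
Qed.

(** * Neighborhoods in terms of a directed family of seminorms *)

Section SeminormedSpace.
Context (K : numFieldType) (X : tvsType K).
Context (I : Type) (p : I -> X -> K).
Hypothesis hp : defining_seminorms p.

Let psemi a : seminorm (p a). Proof. by case: hp. Qed.
Let p_ge0 a x : 0 <= p a x. Proof. exact: seminorm_ge0 (psemi a) x. Qed.
Let pD a x y : p a (x + y) <= p a x + p a y.
Proof. exact: seminormD (psemi a) x y. Qed.

Lemma seminorm0 a : p a 0 = 0.
Proof. by rewrite -(scale0r (0 : X)) (seminormZ (psemi a)) normr0 mul0r. Qed.

Lemma seminormN a x : p a (- x) = p a x.
Proof. by rewrite -scaleN1r (seminormZ (psemi a)) normrN1 mul1r. Qed.

Lemma seminormBC a x y : p a (x - y) = p a (y - x).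
Proof. by rewrite -opprB seminormN. Qed.

Lemma seminormB_trans a x y z : p a (x - z) <= p a (x - y) + p a (y - z).
Proof. by rewrite -[x - z](subrKA y) pD. Qed.

(** Directedness is iterated along an enumeration of [F]; an arbitrary index serves for the empty
    family. *)
Lemma finite_family_bound (F : set I) :
  finite_set F -> exists b, forall a, F a -> forall x, p a x <= p b x.
Proof.
case: hp => -[i0] _ dir _.
(* The alias [{classic I}] supplies the decidable equality on [I] that is needed to enumerate [F] by
   a list. *)
move=> /(@finite_seqP {classic I} F)[s ->].
elim: s => [|a s [b hb]]; first by exists i0.
have [c hc] := dir a b; exists c => d /=; rewrite inE => /orP[/eqP ->|ds] x.
  by case: (hc x).
by apply: le_trans (hb d ds x) _; case: (hc x).
Qed.

Lemma nbhs_seminormP (x : X) (U : set X) :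
  nbhs x U <-> exists a (e : K), 0 < e /\ forall y, p a (y - x) < e -> U y.
Proof.
have [_ _ _ top] := hp; split=> [/top [F [e [finF e0 FU]]]|[a [e [e0 aU]]]].
  have [b hb] := finite_family_bound finF; exists b, e; split=> // y ye.
  by apply: FU => a /hb hab; apply: le_lt_trans (hab _) ye.
by apply/top; exists [set a], e; split=> // y hy; apply/aU/hy.
Qed.

(** If all seminorms vanish at [x], then [0] lies in every neighborhood of [x], so [0] and [x]
    cannot be separated. *)
Lemma seminorm_eq0 : hausdorff_space X ->
  forall x, (forall a, p a x = 0) -> x = 0.
Proof.
move=> hX x px; apply/esym/hX => A B.
move=> /nbhs_seminormP[a [e [e0 aA]]] /nbhs_seminormP[b [d [d0 bB]]].
exists 0; split; first by apply: aA; rewrite subrr seminorm0.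
by apply: bB; rewrite seminormBC subr0 px.
Qed.

(** * Convergence, boundedness and continuity in terms of seminorms *)

Definition seminorm_cvg (u : nat -> X) (l : X) : Prop :=
  forall a (e : K), 0 < e ->
  exists n0, forall n, (n0 <= n)%N -> p a (u n - l) < e.

Lemma cvg_seminorm_cvg u l : u @ \oo --> l -> seminorm_cvg u l.
Proof.
move=> ul a e e0.
have /ul[n0 _ hn0] : nbhs l [set y | p a (y - l) < e].
  by apply/nbhs_seminormP; exists a, e.
by exists n0 => n /hn0.
Qed.

Lemma seminorm_cvg_unique (hX : hausdorff_space X) u l l' :
  seminorm_cvg u l -> seminorm_cvg u l' -> l = l'.
Proof.
move=> ul ul'; apply/eqP; rewrite -subr_eq0; apply/eqP/seminorm_eq0 => // a.
apply/eqP; rewrite eq_le p_ge0 andbT; apply/ler_addgt0Pr => e e0.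
have e20 : 0 < e / 2 by rewrite divr_gt0.
have [n hn] := ul a _ e20; have [m hm] := ul' a _ e20.
rewrite add0r (splitr e).
apply: le_trans (seminormB_trans a _ (u (maxn n m)) _) _.
apply: lerD; last by rewrite ltW // hm // leq_maxr.
by rewrite seminormBC ltW // hn // leq_maxl.
Qed.

Lemma seminorm_cvgS u l : seminorm_cvg u l -> seminorm_cvg (fun n => u n.+1) l.
Proof.
by move=> ul a e /(ul a)[n0 hn0]; exists n0 => n n0n; rewrite hn0 // ltnW.
Qed.

Lemma seminorm_cvg_addl z u l :
  seminorm_cvg u l -> seminorm_cvg (fun n => z + u n) (z + l).
Proof.
move=> ul a e /(ul a)[n0 hn0]; exists n0 => n n0n.
by rewrite opprD addrACA subrr add0r hn0.
Qed.

Lemma seminorm_cvg_continuous (f : X -> X) u l :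
  continuous f -> seminorm_cvg u l -> seminorm_cvg (fun n => f (u n)) (f l).
Proof.
move=> fc ul a e e0.
have /fc : nbhs (f l) [set y | p a (y - f l) < e].
  by apply/nbhs_seminormP; exists a, e.
move=> /nbhs_seminormP[b [d [d0 bd]]].
by have [n0 hn0] := ul b d d0; exists n0 => n /hn0 /bd.
Qed.

Lemma linear_seminorm_le (f : X -> X) : linear f -> continuous f ->
  forall a, exists b (C : K), 0 < C /\ forall x, p a (f x) <= C * p b x.
Proof.
move=> flin fc a.
have /fc : nbhs (f 0) [set y | p a y < 1].
  apply/nbhs_seminormP; exists a, 1; split=> // y.
  by rewrite linear_fun0 // subr0.
move=> /nbhs_seminormP[b [d [d0 bd]]].
exists b, d^-1; split=> [|x]; first by rewrite invr_gt0.
apply/ler_addgt0Pr => e e0.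
(* The summand [e] keeps [r] positive when [p b x = 0], so that [x] can be rescaled by [r^-1] into
   the ball of radius [d]. *)
pose r := d^-1 * p b x + e.
have r0 : 0 < r by rewrite ltr_wpDl // mulr_ge0 // invr_ge0 ltW.
have : p a (f (r^-1 *: x)) < 1.
  apply: bd; rewrite subr0 (seminormZ (psemi b)) gtr0_norm ?invr_gt0 //.
  by rewrite mulrC ltr_pdivrMr // mulrDr mulVKf ?gt_eqF // ltrDl mulr_gt0.
rewrite -[_ *: x]addr0 flin (linear_fun0 flin) addr0.
rewrite (seminormZ (psemi a)) gtr0_norm ?invr_gt0 //.
by rewrite mulrC ltr_pdivrMr // mul1r => /ltW.
Qed.

Lemma bounded_map_seminorm (f : X -> X) : bounded_map f ->
  forall a, exists2 B : K, 0 < B & forall x, p a (f x) <= B.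
Proof.
move=> fb a.
have [|r r0 /(_ r)] := fb [set y | p a y < 1].
  by apply/nbhs_seminormP; exists a, 1; split=> // y; rewrite subr0.
rewrite gtr0_norm // => /(_ (lexx r)) rf; exists r => // x.
have [|y y1 <-] := rf (f x); first by exists x.
rewrite (seminormZ (psemi a)) gtr0_norm //.
by rewrite -[leRHS]mulr1 ler_pM2l // ltW.
Qed.

(* For [Q = [set x]] this is continuity at [x], for [Q = setT] it is uniform
   continuity, so that both cases of the theorem are treated at once. *)
Definition seminorm_continuous_on (Q : set X) (f : X -> X) : Prop :=
  forall a (e : K), 0 < e -> exists b (d : K), 0 < d /\
  forall x y, Q x -> p b (y - x) < d -> p a (f y - f x) < e.

Local Notation cont_on := seminorm_continuous_on.

Lemma continuous_seminormP (f : X -> X) :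
  continuous f <-> forall x, cont_on [set x] f.
Proof.
split=> [fc x a e e0|fc x U /nbhs_seminormP[a [e [e0 aU]]]].
  have /fc : nbhs (f x) [set y | p a (y - f x) < e].
    by apply/nbhs_seminormP; exists a, e.
  by move=> /nbhs_seminormP[b [d [d0 bd]]]; exists b, d; split=> // _ y -> /bd.
have [b [d [d0 bd]]] := fc x a e e0.
by apply/nbhs_seminormP; exists b, d; split=> // y /(bd x y erefl)/aU.
Qed.

Lemma unif_continuous_seminormP (f : X -> X) :
  tvs_unif_continuous f <-> cont_on setT f.
Proof.
split=> [fc a e e0|fc V /nbhs_seminormP[a [e [e0 aV]]]].
  have [|U /nbhs_seminormP[b [d [d0 bU]]] Uf] := fc [set y | p a y < e].
    by apply/nbhs_seminormP; exists a, e; split=> // y; rewrite subr0.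
  by exists b, d; split=> // x y _ yx; apply/Uf/bU; rewrite subr0.
have [b [d [d0 bd]]] := fc a e e0.
exists [set y | p b y < d].
  by apply/nbhs_seminormP; exists b, d; split=> // y; rewrite subr0.
by move=> x y /= yx; apply: aV; rewrite subr0 bd.
Qed.

Lemma seminorm_continuous_onD Q f g :
  cont_on Q f -> cont_on Q g -> cont_on Q (fun x => f x + g x).
Proof.
move=> fc gc a e e0.
have e20 : 0 < e / 2 by rewrite divr_gt0.
have [b [d [d0 bd]]] := fc a _ e20; have [b' [d' [d'0 bd']]] := gc a _ e20.
have [_ _ dir _] := hp; have [c hc] := dir b b'.
have [m [m0 md md']] := min_pos d0 d'0.
exists c, m; split=> // x y Qx yx.
rewrite opprD addrACA (splitr e); apply: le_lt_trans (pD _ _ _) _.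
rewrite ltrD ?bd ?bd' //.
- by apply: le_lt_trans (lt_le_trans yx md); case: (hc (y - x)).
- by apply: le_lt_trans (lt_le_trans yx md'); case: (hc (y - x)).
Qed.

Lemma seminorm_continuous_onN Q f :
  cont_on Q f -> cont_on Q (fun x => - f x).
Proof.
move=> fc a e /(fc a)[b [d [d0 bd]]]; exists b, d; split=> // x y Qx yx.
by rewrite -opprD seminormN bd.
Qed.

Lemma seminorm_continuous_on_id Q : cont_on Q id.
Proof. by move=> a e e0; exists a, e. Qed.

Lemma seminorm_continuous_on_sum Q (g : nat -> X -> X) n :
  (forall k, cont_on Q (g k)) -> cont_on Q (fun x => \sum_(k < n) g k x).
Proof.
move=> gc; elim: n => [|n IHn] a e e0.
  by exists a, e; split=> // x y _ _; rewrite !big_ord0 subr0 seminorm0.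
have [b [d [d0 bd]]] := seminorm_continuous_onD IHn (gc n) a e0.
exists b, d; split=> // x y Qx yx.
by rewrite !big_ord_recr /= bd.
Qed.

(** The [e / 3] argument for uniform limits; the index [n] does not depend on the point, so it
    serves both for [x] and for [y]. *)
Lemma seminorm_continuous_on_lim Q (s : nat -> X -> X) h :
  (forall a (e : K), 0 < e -> exists n, forall x, p a (s n x - h x) < e) ->
  (forall n, cont_on Q (s n)) -> cont_on Q h.
Proof.
move=> sh sc a e e0.
have e30 : 0 < e / 3 by rewrite divr_gt0.
have [n hn] := sh a _ e30; have [b [d [d0 bd]]] := sc n a _ e30.
exists b, d; split=> // x y Qx yx.
have -> : e = e / 3 + (e / 3 + e / 3) by field.
apply: le_lt_trans (seminormB_trans a _ (s n y) _) _.
rewrite ltrD // 1?seminormBC //.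
rewrite seminormBC; apply: le_lt_trans (seminormB_trans a _ (s n x) _) _.
by rewrite ltrD // bd.
Qed.

(** * Series dominated by geometric ones *)

Section Series.
Hypothesis archK : forall x : K, 0 < x -> exists n, x < n%:R.
Hypothesis cX : sequentially_complete X.

Lemma seminorm_geometric_sum (u : nat -> X) a (c t : K) : 0 <= c -> 0 < t < 1 ->
  (forall k, p a (u k) <= c * t ^+ k) ->
  forall m n, (m <= n)%N ->
  p a (\sum_(k < n) u k - \sum_(k < m) u k) <= c / (1 - t) * t ^+ m.
Proof.
move=> c0 /andP[t0 t1] uct m n mn.
have t1n : 1 - t != 0 by rewrite subr_eq0 gt_eqF.
have ct0 : 0 <= c / (1 - t) by rewrite divr_ge0 // subr_ge0 ltW.
(* This sharper bound is the exact value of the dominating geometric sum, so the induction on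
   [n - m] closes with an equality. *)
apply: le_trans (_ : c / (1 - t) * (t ^+ m - t ^+ n) <= _); last first.
  by rewrite ler_wpM2l // gerBl exprn_ge0 // ltW.
rewrite -(subnKC mn); elim: (n - m)%N => [|i IHi].
  by rewrite addn0 !subrr seminorm0 mulr0.
rewrite addnS big_ord_recr /= addrAC; apply: le_trans (pD _ _ _) _.
apply: le_trans (lerD IHi (uct _)) _.
rewrite exprS le_eqVlt; apply/orP; left; apply/eqP; field.
exact: t1n.
Qed.

(** The limit is fixed before the constants: the tail estimate holds for every geometric majorant,
    so that later a majorant adapted to a small [f] can be used for the same sum. *)
Lemma geometric_series_limit (u : nat -> X) :
  (forall a, exists c t : K,
     [/\ 0 <= c, 0 < t < 1 & forall k, p a (u k) <= c * t ^+ k]) ->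
  exists l, forall a (c t : K), 0 <= c -> 0 < t < 1 ->
  (forall k, p a (u k) <= c * t ^+ k) ->
  forall n, p a (\sum_(k < n) u k - l) <= c / (1 - t) * t ^+ n.
Proof.
move=> ubd; pose s n := \sum_(k < n) u k.
have [|l /cvg_seminorm_cvg sl] := cX (u := s).
  move=> V /nbhs_seminormP[a [e [e0 aV]]].
  have [c [t [c0 t01 uct]]] := ubd a.
  have t1 : 0 <= 1 - t by case/andP: t01 => _ /ltW; rewrite subr_ge0.
  have [n0 hn0] := geometric_lt archK (divr_ge0 c0 t1) t01 e0.
  exists n0.
  have bd m n : (n0 <= m)%N -> (m <= n)%N -> p a (s n - s m) < e.
    move=> n0m mn; apply: le_lt_trans (hn0 m n0m).
    exact: seminorm_geometric_sum.
  move=> m n n0m n0n; apply: aV; rewrite subr0.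
  by have [mn|/ltnW nm] := leqP m n; first rewrite seminormBC; apply: bd.
exists l => a c t c0 t01 uct n; apply/ler_addgt0Pr => e e0.
have [m hm] := sl a e e0.
apply: le_trans (seminormB_trans a _ (s (maxn m n)) _) _.
rewrite lerD //; last by rewrite ltW // hm // leq_maxl.
by rewrite seminormBC seminorm_geometric_sum // leq_maxr.
Qed.

(** A common treatment of the two series for [h] and [k]. The bound [B] on [p b (f x)] is
    independent of [x], whence uniform convergence whatever the maps [sigma k] are; the case [n = 0]
    of the tail estimate bounds the sum itself. *)
Lemma conjugacy_series (A : nat -> X -> X) (f : X -> X)
    (sigma : nat -> X -> X) :
  (forall k x y, A k (x - y) = A k x - A k y) ->
  (forall a, exists b (c t : K), [/\ 0 < c, 0 < t < 1 &
     forall k x, p a (A k x) <= c * t ^+ k * p b x]) ->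
  (forall b, exists2 B : K, 0 < B & forall x, p b (f x) <= B) ->
  exists h : X -> X,
  [/\ forall x, seminorm_cvg (fun n => \sum_(k < n) A k (f (sigma k x))) (h x),
      forall a b (c t B : K), 0 < c -> 0 < t < 1 ->
        (forall k x, p a (A k x) <= c * t ^+ k * p b x) ->
        0 < B -> (forall x, p b (f x) <= B) ->
        forall x, p a (h x) <= c * B / (1 - t) &
      forall Q, (forall k, cont_on Q (fun x => f (sigma k x))) -> cont_on Q h].
Proof.
move=> AB Adom fbd.
have term a b (c t B : K) : 0 < c -> 0 < t < 1 ->
    (forall k x, p a (A k x) <= c * t ^+ k * p b x) ->
    (forall x, p b (f x) <= B) ->
    forall x k, p a (A k (f (sigma k x))) <= c * B * t ^+ k.
  move=> c0 /andP[t0 _] Act fB x k; apply: le_trans (Act _ _) _.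
  by rewrite mulrAC ler_pM2r ?exprn_gt0 // ler_pM2l.
have [x|h hh] := choice (P := fun x l => forall a (c t : K), 0 <= c ->
    0 < t < 1 -> (forall k, p a (A k (f (sigma k x))) <= c * t ^+ k) ->
    forall n, p a (\sum_(k < n) A k (f (sigma k x)) - l)
              <= c / (1 - t) * t ^+ n).
  apply: geometric_series_limit => a.
  have [b [c [t [c0 t01 Act]]]] := Adom a; have [B B0 fB] := fbd b.
  exists (c * B), t; split=> //; first by rewrite mulr_ge0 ?ltW.
  exact: term Act fB _.
have unif a (e : K) : 0 < e -> exists n0, forall n, (n0 <= n)%N -> forall x,
    p a (\sum_(k < n) A k (f (sigma k x)) - h x) < e.
  move=> e0.
  have [b [c [t [c0 t01 Act]]]] := Adom a; have [B B0 fB] := fbd b.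
  have cB0 : 0 <= c * B by rewrite mulr_ge0 ?ltW.
  have t1 : 0 <= 1 - t by case/andP: t01 => _ /ltW; rewrite subr_ge0.
  have [n0 hn0] := geometric_lt archK (divr_ge0 cB0 t1) t01 e0.
  exists n0 => n n0n x; apply: le_lt_trans (hn0 n n0n).
  by apply: hh => //; apply: term Act fB _.
exists h; split.
- by move=> x a e /(unif a)[n0 hn0]; exists n0 => n n0n; apply: hn0.
- move=> a b c t B c0 t01 Act B0 fB x.
  have cB0 : 0 <= c * B by rewrite mulr_ge0 ?ltW.
  have := hh x a _ t cB0 t01 (term _ _ _ _ _ c0 t01 Act fB x) 0%N.
  by rewrite big_ord0 sub0r seminormN expr0 mulr1.
- move=> Q fc; apply: (seminorm_continuous_on_lim
    (s := fun n x => \sum_(k < n) A k (f (sigma k x)))).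
    by move=> a e /(unif a)[n0 hn0]; exists n0 => x; apply: hn0.
  move=> n; apply: (seminorm_continuous_on_sum
    (g := fun k x => A k (f (sigma k x)))) => k a e e0.
  (* Being additive, [A k] is Lipschitz from [p b] to [p a] with constant [c * t ^+ k], so each term
     inherits the continuity of [f \o sigma k]. *)
  have [b [c [t [c0 /andP[t0 _] Act]]]] := Adom a.
  have ct0 : 0 < c * t ^+ k by rewrite mulr_gt0 ?exprn_gt0.
  have [b' [d [d0 bd]]] := fc k b _ (divr_gt0 e0 ct0).
  exists b', d; split=> // x y Qx yx.
  rewrite -AB; apply: le_lt_trans (Act _ _) _.
  by rewrite mulrC -ltr_pdivlMr // bd.
Qed.


(** * Construction of the semiconjugacy *)

Section Semiconjugacy.
Hypothesis hX : hausdorff_space X.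
Variable T : GL X.
Hypothesis hT : generalized_hyperbolic_wrt p T.

(** The hyperbolic estimates hold on [M] and [N] only; composing with the projections, which are
    bounded from one seminorm to another, extends them to all of [X]. In the second estimate the
    extra factor [t] of the exponent [n.+1] is absorbed into the constant. *)
Lemma generalized_hyperbolic_projections :
  exists P Q : X -> X,
  [/\ forall x, P x + Q x = x,
     forall x y, P (x - y) = P x - P y,
     forall x y, Q (x - y) = Q x - Q y,
     forall a, exists b (c t : K), [/\ 0 < c, 0 < t < 1 &
       forall n x, p a (iter n T (P x)) <= c * t ^+ n * p b x] &
     forall a, exists b (c t : K), [/\ 0 < c, 0 < t < 1 &
       forall n x, p a (iter n.+1 (GL_inv T) (Q x)) <= c * t ^+ n * p b x]].
Proof.
have [M [N [MN _ _ hyp]]] := hT.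
have [P [Q [MNP PQ [Pl Ql] [Pc Qc]]]] := topological_direct_sum_projections MN.
exists P, Q; split=> //; [exact: linear_fun_sub..| |] => a.
- have [b [c [t [c0 t01 Mt _]]]] := hyp a.
  have [b' [C [C0 PC]]] := linear_seminorm_le Pl Pc b.
  exists b', (c * C), t; split; rewrite ?mulr_gt0 // => n x.
  have t0 : 0 < t by case/andP: t01.
  apply: le_trans (Mt n _ _) _; first by case: (MNP x).
  have -> : c * C * t ^+ n * p b' x = c * t ^+ n * (C * p b' x) by ring.
  by rewrite ler_pM2l // mulr_gt0 ?exprn_gt0.
- have [b [c [t [c0 t01 _ Nt]]]] := hyp a.
  have [b' [C [C0 QC]]] := linear_seminorm_le Ql Qc b.
  have t0 : 0 < t by case/andP: t01.
  exists b', (c * t * C), t; split; rewrite ?mulr_gt0 // => n x.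
  apply: le_trans (Nt n.+1 _ _) _; first by case: (MNP x).
  have -> : c * t * C * t ^+ n * p b' x = c * t ^+ n.+1 * (C * p b' x).
    by rewrite exprS; ring.
  by rewrite ler_pM2l // mulr_gt0 ?exprn_gt0.
Qed.

(** [U] is built from [V] and the hyperbolicity constants alone, before [S] is given. The set [D]
    leaves open which kind of continuity is passed on to [phi]: at a point or uniform. *)
Lemma generalized_hyperbolic_semiconjugacy (V : set X) : nbhs (0 : X) V ->
  exists2 U : set X, nbhs (0 : X) U &
  forall S S' : X -> X, cancel S S' -> cancel S' S ->
  bounded_map (fun x => T x - S x) -> (forall x, U (T x - S x)) ->
  exists phi : X -> X,
  [/\ T \o phi = phi \o S, forall x, V (phi x - x) &
    forall D,
    (forall n, cont_on D (fun x => T (iter n S x) - S (iter n S x))) ->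
    (forall n, cont_on D (fun x => T (iter n S' x) - S (iter n S' x))) ->
    cont_on D phi].
Proof.
have [P [Q [PQ PB QB Phyp Qhyp]]] := generalized_hyperbolic_projections.
have Tc : continuous T by exact: GL_continuous.
have TB x y : T (x - y) = T x - T y by exact: linearB.
have T'B := linear_fun_sub (@GL_inv_linear _ _ T).
move=> /nbhs_seminormP[a [e [e0 aV]]].
have e30 : 0 < e / 3 by rewrite divr_gt0.
have [b [c [t [c0 t01 Pt]]]] := Phyp a.
have [b' [c' [t' [c'0 t'01 Qt]]]] := Qhyp a.
have t1 : 0 < 1 - t by case/andP: t01; rewrite subr_gt0.
have t'1 : 0 < 1 - t' by case/andP: t'01; rewrite subr_gt0.
(* Chosen so that the bounds [c * B / (1 - t)] and [c' * B' / (1 - t')] on the two series both equal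
   [e / 3]. *)
pose B := e / 3 * (1 - t) / c; pose B' := e / 3 * (1 - t') / c'.
have B0 : 0 < B by exact: divr_gt0 (mulr_gt0 e30 t1) c0.
have B'0 : 0 < B' by exact: divr_gt0 (mulr_gt0 e30 t'1) c'0.
exists [set x | p b x < B /\ p b' x < B'].
  by apply: filterI; apply/nbhs_seminormP;
    [exists b, B | exists b', B']; split=> // y; rewrite subr0.
move=> S S' SK S'K fb fU; pose f x := T x - S x.
have fbd := bounded_map_seminorm fb.
have [h [hlim hbd hcont]] := conjugacy_series
  (A := fun n x => iter n T (P x)) (fun n => iter n.+1 S')
  (fun n x y => etrans (congr1 _ (PB x y)) (iter_sub TB n _ _)) Phyp fbd.
have [k [klim kbd kcont]] := conjugacy_series
  (A := fun n x => iter n.+1 (GL_inv T) (Q x)) (fun n => iter n S)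
  (fun n x y => etrans (congr1 _ (QB x y)) (iter_sub T'B n.+1 _ _)) Qhyp fbd.
(* At [S x] the initial term is [P (f x)], since [S'] cancels one [S]; the remaining terms are the
   images under [T] of those at [x]. The identity of partial sums passes to the limit, which is
   unique. *)
have hS x : h (S x) = P (f x) + T (h x).
  apply: seminorm_cvg_unique (seminorm_cvgS (hlim (S x))) _ => //.
  have := seminorm_cvg_addl (P (f x)) (seminorm_cvg_continuous Tc (hlim x)).
  congr seminorm_cvg; apply/funext => n.
  rewrite big_ord_recl /= SK linear_sum; congr (_ + _); apply: eq_bigr => i _.
  by rewrite /= -!iterS !iterSr SK.
(* Here [T] cancels one factor [GL_inv T] in each term: the initial one becomes [Q (f x)], the
   others form the series at [S x]. *)
have Tk x : T (k x) = Q (f x) + k (S x).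
  have kS := seminorm_cvgS (klim x).
  apply: seminorm_cvg_unique (seminorm_cvg_continuous Tc kS) _ => //.
  have := seminorm_cvg_addl (Q (f x)) (klim (S x)).
  congr seminorm_cvg; apply/funext => n.
  rewrite big_ord_recl /= linearD /= (GL_invK T) linear_sum; congr (_ + _).
  by apply: eq_bigr => i _; rewrite /= (GL_invK T) add0n -iterSr.
exists (fun x => x + (h x - k x)); split.
- apply/funext => x /=; rewrite linearD linearB /= Tk hS.
  have -> : T x = S x + (P (f x) + Q (f x)) by rewrite PQ /f addrC subrK.
  rewrite -addrA; congr (_ + _).
  by rewrite opprD addrACA addNKr.
- move=> x; apply: aV; rewrite subr0 addrC addKr.
  (* The two series bounds are only weak inequalities; taking thirds rather than halves makes the
     total strictly less than [e]. *)
  apply: le_lt_trans (_ : e / 3 + e / 3 < e).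
    apply: le_trans (pD _ _ _) _; rewrite seminormN.
    apply: lerD.
    + apply: le_trans (hbd a b c t B c0 t01 Pt B0 _ x) _.
        by move=> y; case: (fU y) => /ltW.
      rewrite le_eqVlt /B; apply/orP; left; apply/eqP; field.
      by rewrite !gt_eqF.
    + apply: le_trans (kbd a b' c' t' B' c'0 t'01 Qt B'0 _ x) _.
        by move=> y; case: (fU y) => _ /ltW.
      rewrite le_eqVlt /B'; apply/orP; left; apply/eqP; field.
      by rewrite !gt_eqF.
  rewrite -subr_gt0; have -> : e - (e / 3 + e / 3) = e / 3 by field.
  by [].
- move=> D fS fS'; apply: seminorm_continuous_onD.
    exact: seminorm_continuous_on_id.
  apply: seminorm_continuous_onD.
    by apply: hcont => n; apply: fS'.
  exact/seminorm_continuous_onN/kcont.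
Qed.

End Semiconjugacy.
End Series.
End SeminormedSpace.

(** Both cases use the same [U] and the same construction of [phi], with [D] a singleton for
    continuity and [setT] for uniform continuity. It remains to see that [T - S] composed with
    iterates of [S] and of its inverse is continuous in the respective sense. *)
Theorem theorem26 (R : realType) (cplx : bool)
    (X : tvsType (scalar_field R cplx)) (hX : hausdorff_space X)
    (cX : sequentially_complete X)
    (I : Type) (p : I -> X -> scalar_field R cplx) (hp : defining_seminorms p)
    (T : GL X) (hT : generalized_hyperbolic_wrt p T)
    (V : set X) (hV : nbhs (0 : X) V) :
  exists2 U : set X, nbhs (0 : X) U &
    (forall S : X -> X, homeomorphism S ->
       bounded_map (fun x => T x - S x) -> (forall x, U (T x - S x)) ->
       exists phi : X -> X,
         [/\ continuous phi, T \o phi = phi \o S & forall x, V (phi x - x)]) /\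
    (forall S : X -> X, uniform_homeomorphism S ->
       bounded_map (fun x => T x - S x) -> (forall x, U (T x - S x)) ->
       exists phi : X -> X,
         [/\ tvs_unif_continuous phi, T \o phi = phi \o S
           & forall x, V (phi x - x)]).
Proof.
have [U U0 hU] := generalized_hyperbolic_semiconjugacy hp
  (@scalar_field_archi R cplx) cX hX hT hV.
exists U => //; split=> S [Sc [S' [SK S'K S'c]]] fb fU.
- have [phi [Tphi phiV phic]] := hU S S' SK S'K fb fU.
  exists phi; split=> //; apply/(continuous_seminormP hp) => x.
  have fc (g : X -> X) : continuous g ->
      seminorm_continuous_on p [set x] (fun x => T (g x) - S (g x)).
    move=> gc; apply: (seminorm_continuous_onD hp).
      move: x; apply/(continuous_seminormP hp) => x.
      exact: (continuous_comp (gc x) (@GL_continuous _ _ T _)).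
    apply: (seminorm_continuous_onN hp).
    move: x; apply/(continuous_seminormP hp) => x.
    exact: (continuous_comp (gc x) (Sc _)).
  by apply: phic => n; apply/fc/iter_continuous.
- have [phi [Tphi phiV phic]] := hU S S' SK S'K fb fU.
  exists phi; split=> //; apply/(unif_continuous_seminormP hp).
  (* A continuous linear map is Lipschitz from some seminorm to any given one, hence uniformly
     continuous. *)
  have Tc : tvs_unif_continuous T.
    apply/(unif_continuous_seminormP hp) => a e e0.
    have [b [C [C0 TC]]] := linear_seminorm_le hp (@linearP _ _ _ _ T)
      (@GL_continuous _ _ T) a.
    exists b, (e / C); split=> [|x y _ yx]; first by rewrite divr_gt0.
    rewrite -linearB; apply: le_lt_trans (TC _) _.
    by rewrite mulrC -ltr_pdivlMr.
  have fc (g : X -> X) : tvs_unif_continuous g ->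
      seminorm_continuous_on p setT (fun x => T (g x) - S (g x)).
    move=> gc; apply: (seminorm_continuous_onD hp).
      apply/(unif_continuous_seminormP hp).
      exact: tvs_unif_continuous_comp gc Tc.
    apply/(seminorm_continuous_onN hp)/(unif_continuous_seminormP hp).
    exact: tvs_unif_continuous_comp gc Sc.
  by apply: phic => n; apply/fc/tvs_unif_continuous_iter.
Qed.
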